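(* Consider the recursive network formation model with the utility function described in the context. Suppose $$\gamma<\frac{b_2-b_3}{3b_2-b_3},$$ $$b_1-b_2+\gamma(3b_2-b_3)<c<b_1-b_3, \quad\text{and}\quad (1-\gamma)(b_2-b_3)<c_0\le(1-\gamma)b_2.$$ Then the resulting topology is a bipartite Turán graph: starting from a single node, for every $n\ge1$, the pairwise stable network reached after the $n$-th node has entered is the complete bipartite graph on $n$ nodes with parts of sizes $\lfloor n/2\rfloor$ and $\lceil n/2\rceil$, irrespective of the random order in which nodes are selected to move.
   Context: Networks are finite simple undirected graphs whose vertices (nodes) are self-interested agents. Parameters: benefits $b_1>b_2>b_3>b_4>\dots>0$, where $b_i$ is the benefit a node obtains from a node at distance $i$; a link cost $c$ per immediate neighbor; an intermediation fraction $\gamma$ with $0\le\gamma<1$; and a network entry factor $c_0$. Notation: $N$ is the set of nodes currently in the network, $d_j$ the degree of $j$, and $l(j,w)$ the graph distance. A node $x$ is essential for a pair $y,z$ (with $x\notin\{y,z\}$) if $x$ lies on every path joining $y$ and $z$. Write $E(y,z)$ for the set of nodes essential for $y,z$ and $e(y,z)=|E(y,z)|$. Only pairs joined by a path contribute to the sums below. Utility of node $j$ in network $g$: $$u_j(g)=-c_0\,d_{T(j)}\mathbf 1_{\{j=\mathrm{NE}\}}+d_j(b_1-c)+\sum_{w\in N,\ l(j,w)>1}b_{l(j,w)}-\sum_{w\in N,\ E(j,w)\ne\emptyset}\gamma\, b_{l(j,w)}+\sum_{y,z\in N,\ j\in E(y,z)}\frac{\gamma}{e(y,z)}\,2\,b_{l(y,z)}.$$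 Here $\mathbf 1_{\{j=\mathrm{NE}\}}=1$ exactly when $j$ is a newly entering node evaluating the creation of its first link. $T(j)$ is the existing node to which $j$ forms that first link, and $d_{T(j)}$ is that node's degree before the link. The network before entry gives the entering node utility $0$. Pairwise stability: $g$ is pairwise stable if (a) for every link $(i,j)\in g$, $u_i(g\setminus\{(i,j)\})\le u_i(g)$ and $u_j(g\setminus\{(i,j)\})\le u_j(g)$; and (b) for every non-link $(i,j)\notin g$, if $u_i(g\cup\{(i,j)\})>u_i(g)$ then $u_j(g\cup\{(i,j)\})<u_j(g)$. Recursive model of network formation: - The process starts with a single node. - When the current network of $n-1$ nodes is pairwise stable, a new node considers entering. Its options are to stay out or to propose a link to one existing node. The link forms iff the receiving node's utility does not decrease. No existing node can link to the newcomer before it has formed this first link. - After entry, nodes are repeatedly chosen at random to move. A chosen node plays a myopic best response among three options: create a link with a non-neighbor (the link forms only if the other node's utility does not decrease, which the proposer anticipates); delete a link with a neighbor (unilaterally); or keep the status quo. It alters a link only if this strictly increases its current utility. - This continues until the network is pairwise stable; then the next node considers entering, and so on. ''The resulting topology is X'' means: for every number $n$ of nodes, every pairwise stable network reached after the $n$-th node has entered is a network of topology X on $n$ nodes, irrespective of the random choices. *)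

(* Defs.v *)
(* Networks on the node set N = {0, ..., n-1} (nodes are nats),
   a network being a boolean adjacency relation on nat. *)
From HB Require Import structures.
From mathcomp Require Import all_boot all_order all_algebra.
Set Implicit Arguments. Unset Strict Implicit. Unset Printing Implicit Defensive.
Import Order.TTheory GRing.Theory Num.Theory.
Local Open Scope ring_scope.

Definition graph := nat -> nat -> bool.

Definition empty_graph : graph := fun _ _ => false.

Definition add_link (g : graph) (i j : nat) : graph :=
  fun x y => [|| g x y, (x == i) && (y == j) | (x == j) && (y == i)].
Definition del_link (g : graph) (i j : nat) : graph :=
  fun x y => g x y && ~~ (((x == i) && (y == j)) || ((x == j) && (y == i))).

Fixpoint walk_k (ok : pred nat) (g : graph) (n k : nat) (x y : nat) : bool :=
  match k with
  | 0 => x == y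
  | k'.+1 => walk_k ok g n k' x y ||
      has (fun w => [&& ok w, walk_k ok g n k' x w & g w y]) (iota 0 n)
  end.

Definition conn (g : graph) (n x y : nat) : bool := walk_k predT g n n x y.

Definition dist (g : graph) (n x y : nat) : nat :=
  find (fun k => walk_k predT g n k x y) (iota 0 n.+1).

Definition essential (g : graph) (n x y z : nat) : bool :=
  [&& (x < n)%N, x != y, x != z, conn g n y z &
      ~~ walk_k (fun w => w != x) g n n y z].

Definition ness (g : graph) (n y z : nat) : nat :=
  count (fun x => essential g n x y z) (iota 0 n).

Definition deg (g : graph) (n j : nat) : nat := count (g j) (iota 0 n).

(* Utility u_j(g) of node j (without the entry term, which only applies
   to a newly entering node evaluating its first link). *)
Definition util {R : realFieldType} (b : nat -> R) (c gamma : R)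
    (g : graph) (n j : nat) : R :=
  (deg g n j)%:R * (b 1%N - c)
  + \sum_(w <- iota 0 n | conn g n j w && (1 < dist g n j w)%N) b (dist g n j w)
  - \sum_(w <- iota 0 n | conn g n j w && (ness g n j w != 0%N))
        gamma * b (dist g n j w)
  + \sum_(y <- iota 0 n) \sum_(z <- iota 0 n | (y < z)%N && essential g n j y z)
        gamma / (ness g n y z)%:R * 2 * b (dist g n y z).

Definition pairwise_stable {R : realFieldType} (b : nat -> R) (c gamma : R)
    (n : nat) (g : graph) : Prop :=
  (forall i j, (i < n)%N -> (j < n)%N -> g i j ->
      util b c gamma (del_link g i j) n i <= util b c gamma g n i /\
      util b c gamma (del_link g i j) n j <= util b c gamma g n j) /\
  (forall i j, (i < n)%N -> (j < n)%N -> i != j -> ~~ g i j ->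
      util b c gamma g n i < util b c gamma (add_link g i j) n i ->
      util b c gamma (add_link g i j) n j < util b c gamma g n j).

Definition can_add {R : realFieldType} (b : nat -> R) (c gamma : R)
    (n : nat) (g : graph) (i j : nat) : bool :=
  [&& (j < n)%N, j != i, ~~ g i j &
      util b c gamma g n j <= util b c gamma (add_link g i j) n j].

Definition br_bound {R : realFieldType} (b : nat -> R) (c gamma : R)
    (n : nat) (g : graph) (i : nat) (v : R) : Prop :=
  util b c gamma g n i <= v /\
  forall k, (can_add b c gamma n g i k -> util b c gamma (add_link g i k) n i <= v)
         /\ (g i k -> util b c gamma (del_link g i k) n i <= v).

Definition entry_util {R : realFieldType} (b : nat -> R) (c gamma c0 : R)
    (n : nat) (g : graph) (t : nat) : R :=
  - c0 * (deg g n t)%:R + util b c gamma (add_link g n t) n.+1 n.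

Definition accepts {R : realFieldType} (b : nat -> R) (c gamma : R)
    (n : nat) (g : graph) (t : nat) : bool :=
  util b c gamma g n t <= util b c gamma (add_link g n t) n.+1 t.

(* reached b c gamma c0 n g : the network g on n nodes can arise in the
   recursive model after the n-th node has entered (before or after
   reaching pairwise stability), for some sequence of random choices. *)
Inductive reached {R : realFieldType} (b : nat -> R) (c gamma c0 : R)
  : nat -> graph -> Prop :=
| reached_init : reached b c gamma c0 1 empty_graph
| reached_entry n g t :
    reached b c gamma c0 n g ->
    pairwise_stable b c gamma n g ->
    (t < n)%N ->
    accepts b c gamma n g t ->
    0 < entry_util b c gamma c0 n g t ->
    (forall t', (t' < n)%N -> accepts b c gamma n g t' ->
        entry_util b c gamma c0 n g t' <= entry_util b c gamma c0 n g t) ->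
    reached b c gamma c0 n.+1 (add_link g n t)
| reached_add n g i j :
    reached b c gamma c0 n g ->
    ~ pairwise_stable b c gamma n g ->
    (i < n)%N ->
    can_add b c gamma n g i j ->
    util b c gamma g n i < util b c gamma (add_link g i j) n i ->
    br_bound b c gamma n g i (util b c gamma (add_link g i j) n i) ->
    reached b c gamma c0 n (add_link g i j)
| reached_del n g i j :
    reached b c gamma c0 n g ->
    ~ pairwise_stable b c gamma n g ->
    (i < n)%N ->
    g i j ->
    util b c gamma g n i < util b c gamma (del_link g i j) n i ->
    br_bound b c gamma n g i (util b c gamma (del_link g i j) n i) ->
    reached b c gamma c0 n (del_link g i j).

Definition bipartite_turan (n : nat) (g : graph) : Prop :=
  exists A : pred nat, count A (iota 0 n) = n./2 /\
    forall x y, (x < n)%N -> (y < n)%N -> g x y = (A x != A y).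

(* Main.v *)
(* Invariant: the network is bipartite with sides A, of size n/2, and B; all
   A-B links are present except possibly some at a single node v of B, the
   newcomer, which has a link if A is nonempty.
   - A link between nodes at distance at least 3 strictly benefits both ends.
     Bipartite endpoints of a deleted link are at distance at least 3, so no link
     is deleted, and a missing A-v link contradicts stability.
   - Two nodes of the same side have nested neighbourhoods.  Linking x to y when
     N(x) is contained in N(y) only shortens, from the viewpoint of y, its
     distance to x and possibly that of x to a single neighbour of y cut off from
     x by y; the lower bound on c makes y lose.
   - In a complete bipartite network the newcomer strictly prefers a node of
     minimal degree, i.e. of the larger side, because c0 > (1-gamma)(b 2 - b 3). *)
Require Import Defs.
From HB Require Import structures.
From mathcomp Require Import all_boot all_order all_algebra.
From mathcomp Require Import ring lra zify.
Set Implicit Arguments. Unset Strict Implicit. Unset Printing Implicit Defensive.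
Import Order.TTheory GRing.Theory Num.Theory.

(** * Walks of bounded length through admissible nodes *)

Lemma walkS (ok : pred nat) (g : graph) (n k x y : nat) :
  walk_k ok g n k.+1 x y = walk_k ok g n k x y ||
    has (fun w => [&& ok w, walk_k ok g n k x w & g w y]) (iota 0 n).
Proof. by []. Qed.

(** Contracting a step is harmless because [k] only bounds the length from above. The last node of a
    walk is not tested by [ok'], so [D] records what is known of it. *)
Lemma walk_hom (ok ok' D : pred nat) (g g' : graph) (n n' : nat)
    (phi : nat -> nat) (k p q : nat) :
  (forall u, ok' u -> u < n' -> D u) ->
  (forall u w, ok' u -> u < n' -> D w -> g' u w ->
     phi u = phi w \/ [/\ ok (phi u), phi u < n & g (phi u) (phi w)]) ->
  D q -> walk_k ok' g' n' k p q -> walk_k ok g n k (phi p) (phi q).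
Proof.
move=> okD homg; elim: k q => [|k IH] q Dq /=; first by move/eqP->.
case/orP=> [/(IH _ Dq) -> // | /hasP[w]].
rewrite mem_iota => /= wn /and3P[okw pw gwq].
have pw' := IH _ (okD _ okw wn) pw.
case: (homg _ _ okw wn Dq gwq) => [<- | [okf fn gf]]; first by rewrite pw'.
apply/orP; right; apply/hasP; exists (phi w); rewrite ?mem_iota //.
by rewrite okf pw'.
Qed.

Lemma walk_mono (ok : pred nat) (g : graph) (n k m p q : nat) :
  k <= m -> walk_k ok g n k p q -> walk_k ok g n m p q.
Proof.
by move/subnK <-; elim: (m - k) => //= d IH /IH ->.
Qed.

Lemma walk_rcons (ok : pred nat) (g : graph) (n k p w q : nat) :
  walk_k ok g n k p w -> ok w -> w < n -> g w q -> walk_k ok g n k.+1 p q.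
Proof.
move=> pw okw wn gwq /=; apply/orP; right; apply/hasP.
by exists w; rewrite ?mem_iota // okw pw.
Qed.

Lemma walk_cons (ok : pred nat) (g : graph) (n k p w q : nat) :
  ok p -> p < n -> g p w -> walk_k ok g n k w q -> walk_k ok g n k.+1 p q.
Proof.
move=> okp pn gpw; elim: k q => [|k IH] q.
  by move=> /= /eqP <-; apply: (@walk_rcons _ _ _ 0 _ p) => //=.
case/orP=> [/IH wq | /hasP[u]]; first by apply: (walk_mono _ wq).
rewrite mem_iota => /= un /and3P[oku wu guq].
by apply: (walk_rcons (IH _ wu)).
Qed.

Lemma walk_sym (ok : pred nat) (g : graph) (n k p q : nat) :
  symmetric g -> (forall u w, g u w -> u < n) -> ok q ->
  walk_k ok g n k p q -> walk_k ok g n k q p.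
Proof.
move=> gC gn; elim: k q => [|k IH] q okq; first by rewrite /= eq_sym.
case/orP=> [/(IH _ okq) wq | /hasP[u]]; first by apply: (walk_mono _ wq).
rewrite mem_iota => /= un /and3P[oku wu guq].
by apply: walk_cons (IH _ oku wu) => //; rewrite 1?gC //; apply: (gn _ u); rewrite gC.
Qed.

(** This translation to library paths makes loop removal available; [belast] reflects that the final
    node is tested neither for [ok] nor for being below [n]. *)
Lemma walk_path (ok : pred nat) (g : graph) (n k x y : nat) :
  reflect (exists p, [/\ path g x p, last x p = y,
              all (fun w => ok w && (w < n)) (belast x p) & size p <= k])
          (walk_k ok g n k x y).
Proof.
apply: (iffP idP).
  elim: k y => [|k IH] y; first by move=> /= /eqP <-; exists [::].
  case/orP=> [/IH[p [? ? ? sp]] | /hasP[w]].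
    by exists p; split=> //; apply: leqW.
  rewrite mem_iota => /= wn /and3P[okw /IH[p [pp lp ap sp]] gwy].
  exists (rcons p y); rewrite rcons_path last_rcons size_rcons pp lp gwy.
  by split=> //; rewrite belast_rcons lastI lp all_rcons okw wn ap.
case=> p []; elim/last_ind: p k y => [|p z IH] k y.
  by move=> _ /= -> _ _; apply: (@walk_mono _ _ _ 0) => //=.
rewrite rcons_path last_rcons belast_rcons lastI all_rcons size_rcons.
case/andP=> pp gz <- /andP[/andP[okl ln] ap].
case: k => // k sk; apply: walk_rcons okl ln gz.
exact: IH.
Qed.

(** Remove the loops: the nodes before the last one are then distinct and below [n], so at most [n]
    steps remain. Hence the bound [n] in [conn] and [essential] loses no walk. *)
Lemma walk_sat (ok : pred nat) (g : graph) (n k x y : nat) :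
  walk_k ok g n k x y -> walk_k ok g n n x y.
Proof.
case/walk_path=> p [pp lp /allP ap _]; apply/walk_path.
case/shortenP: pp (lp) => p' pp' up' sub lp'.
have ap' z : z \in belast x p' -> ok z && (z < n).
  move=> zp; apply: ap.
  have zl : z != last x p.
    move: up'; rewrite lastI rcons_uniq => /andP[/negP nl _].
    by apply/eqP=> zE; apply: nl; rewrite lp' -lp -zE.
  have : z \in x :: p.
    have := mem_belast zp; rewrite !inE => /orP[->//|/sub ->].
    by rewrite orbT.
  by rewrite lastI mem_rcons inE (negPf zl).
exists p'; split=> //; first exact/allP.
have ub : uniq (belast x p') by move: up'; rewrite lastI rcons_uniq => /andP[].
rewrite -(size_belast x) -[leqRHS](size_iota 0); apply: uniq_leq_size => // z.
by move/ap'=> /andP[_ zn]; rewrite mem_iota.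
Qed.

(** * Connectedness, distance and essential nodes *)

Lemma connW (g : graph) (n k p q : nat) :
  walk_k predT g n k p q -> conn g n p q.
Proof. exact: walk_sat. Qed.

Lemma dist_le (g : graph) (n k p q : nat) :
  walk_k predT g n k p q -> dist g n p q <= k.
Proof.
move=> wk; rewrite /dist leqNgt; apply/negP => lt.
have := before_find 0 lt; rewrite nth_iota ?add0n ?wk //.
by apply: (leq_trans lt); rewrite -[leqRHS](size_iota 0) find_size.
Qed.

Lemma walk_dist (g : graph) (n p q : nat) :
  conn g n p q -> walk_k predT g n (dist g n p q) p q.
Proof.
move=> cpq; have hs : has (fun k => walk_k predT g n k p q) (iota 0 n.+1).
  by apply/hasP; exists n; rewrite // mem_iota add0n ltnSn.
have := nth_find 0 hs; rewrite nth_iota //.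
by rewrite -[ltnRHS](size_iota 0) -has_find.
Qed.

Lemma dist_leE (g : graph) (n k p q : nat) : conn g n p q ->
  (dist g n p q <= k) = walk_k predT g n k p q.
Proof.
move=> cpq; apply/idP/idP; last exact: dist_le.
by move=> le; apply: walk_mono (walk_dist cpq).
Qed.

Lemma walk1 (ok : pred nat) (g : graph) (n p q : nat) :
  walk_k ok g n 1 p q = (p == q) || [&& ok p, p < n & g p q].
Proof.
apply/idP/idP => /=.
  case/orP=> [-> // | /hasP[w]]; rewrite mem_iota => /= wn /and3P[okw /eqP pw gw].
  by rewrite pw okw wn gw orbT.
case/orP=> [-> // | /and3P[okp pn gpq]]; apply/orP; right; apply/hasP.
by exists p; rewrite ?mem_iota // okp eqxx.
Qed.

Lemma dist_gt0 (g : graph) (n p q : nat) :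
  p != q -> conn g n p q -> 0 < dist g n p q.
Proof.
move=> pq cpq; rewrite lt0n; apply: contra pq => /eqP d0.
by have := walk_dist cpq; rewrite d0.
Qed.

Lemma dist_gt1 (g : graph) (n p q : nat) : p < n -> conn g n p q ->
  (1 < dist g n p q) = (p != q) && ~~ g p q.
Proof. by move=> pn cpq; rewrite ltnNge dist_leE // walk1 pn negb_or. Qed.

Lemma ness_gt0 (g : graph) (n p q : nat) :
  (ness g n p q != 0) = has (fun z => essential g n z p q) (iota 0 n).
Proof. by rewrite -lt0n -has_count. Qed.

Lemma ness_adj (g : graph) (n p q : nat) :
  conn g n p q -> dist g n p q <= 1 -> ness g n p q = 0.
Proof.
move=> cpq; rewrite dist_leE // walk1 => w1; apply/eqP/negPn.
rewrite ness_gt0; apply/negP => /hasP[z _ /and5P[_ zp _ _ /negP[]]].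
apply: (@walk_sat _ _ _ 1); rewrite walk1.
by case/orP: w1 => [-> // | /and3P[_ -> ->]]; rewrite (eq_sym p z) zp orbT.
Qed.

Lemma ness_essential (g : graph) (n x p q : nat) :
  essential g n x p q -> 0 < ness g n p q.
Proof.
move=> e; rewrite lt0n ness_gt0; apply/hasP; exists x => //.
by case/andP: e; rewrite mem_iota.
Qed.

Lemma deg_add (g g' : graph) (n x y : nat) : y < n -> ~~ g x y ->
  (forall w, g' x w = g x w || (w == y)) -> deg g' n x = (deg g n x).+1.
Proof.
move=> yn ngxy nbr.
rewrite /deg (eq_count (a2 := predU (g x) (pred1 y))) //.
have := count_predUI (g x) (pred1 y) (iota 0 n).
rewrite [count (predI _ _) _](_ : _ = 0).
  by rewrite addn0 => ->; rewrite count_uniq_mem ?iota_uniq // mem_iota yn addn1.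
rewrite -[RHS](count_pred0 (iota 0 n)); apply: eq_count => z /=.
by apply/negP => /andP[gz /eqP zy]; rewrite -zy gz in ngxy.
Qed.

Section Symmetric.

Variables (g : graph) (n : nat).
Hypotheses (gC : symmetric g) (gn : forall u w, g u w -> u < n).

Lemma conn_sym p q : conn g n p q = conn g n q p.
Proof. by apply/idP/idP; apply: walk_sym. Qed.

Lemma essential_sym x p q : essential g n x p q = essential g n x q p.
Proof.
rewrite /essential conn_sym; case: ltnP => //= _.
case: (eqVneq x p) => [->|xp]; first by rewrite andbF.
case: (eqVneq x q) => //= xq; congr (_ && ~~ _).
by apply/idP/idP; apply: walk_sym; rewrite // eq_sym.
Qed.

Lemma ness_sym p q : ness g n p q = ness g n q p.
Proof. by apply: eq_count => z; apply: essential_sym. Qed.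

Lemma dist_sym p q : dist g n p q = dist g n q p.
Proof. by apply: eq_find => k; apply/idP/idP; apply: walk_sym. Qed.

End Symmetric.

Local Open Scope ring_scope.

(** * Comparison of sums over nodes and over pairs of nodes *)

Section IotaSums.

Variable R : realFieldType.

Lemma sum_iota_delta (n y : nat) (L : R) :
  (y < n)%N -> \sum_(w <- iota 0 n) (w == y)%:R * L = L.
Proof.
move=> yn; rewrite (bigD1_seq y) ?iota_uniq ?mem_iota //= eqxx mul1r big1 ?addr0 //.
by move=> w /negPf ->; rewrite mul0r.
Qed.

Lemma sum_iota_le (n n' : nat) (F F' : nat -> R) : (n <= n')%N ->
  (forall w, (w < n)%N -> F w <= F' w) -> (forall w, 0 <= F' w) ->
  \sum_(w <- iota 0 n) F w <= \sum_(w <- iota 0 n') F' w.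
Proof.
move=> nn' le ge0; rewrite -(subnKC nn') iotaD big_cat /= -[leLHS]addr0.
apply: lerD; last exact: sumr_ge0.
by rewrite big_seq [leRHS]big_seq; apply: ler_sum => w; rewrite mem_iota => /le.
Qed.

Lemma sum_iota_delta_le (n y : nat) (L : R) :
  0 <= L -> \sum_(w <- iota 0 n) (w == y)%:R * L <= L.
Proof.
move=> L0; case: (ltnP y n) => [yn|ny]; first by rewrite sum_iota_delta.
rewrite big_seq big1 // => w; rewrite mem_iota => /= wn.
by rewrite ltn_eqF ?mul0r // (leq_trans wn).
Qed.

(** Used to charge an amount [K] to one exceptional pair. An inequality suffices, and it holds even
    if [(m, M)] is out of range or not increasing. *)
Lemma sum_pairs_delta_le (n m M : nat) (K : R) : 0 <= K ->
  \sum_(p <- iota 0 n) \sum_(q <- iota 0 n | (p < q)%N)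
     (p == m)%:R * ((q == M)%:R * K) <= K.
Proof.
move=> K0; apply: le_trans (sum_iota_delta_le n m K0); apply: ler_sum => p _.
rewrite -mulr_sumr; apply: ler_wpM2l; first exact: ler0n.
rewrite big_mkcond; apply: le_trans (sum_iota_delta_le n M K0).
by apply: ler_sum => q _; case: ifP => // _; rewrite mulr_ge0.
Qed.

Lemma sum_pairs_le (n n' : nat) (G G' : nat -> nat -> R) : (n <= n')%N ->
  (forall p q, (p < q)%N -> (q < n)%N -> G p q <= G' p q) ->
  (forall p q, (p < q)%N -> 0 <= G' p q) ->
  \sum_(p <- iota 0 n) \sum_(q <- iota 0 n | (p < q)%N) G p q <=
  \sum_(p <- iota 0 n') \sum_(q <- iota 0 n' | (p < q)%N) G' p q.
Proof.
move=> nn' le ge0; apply: sum_iota_le => // [p pn|p].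
2: by apply: sumr_ge0 => q /ge0.
rewrite big_mkcond [leRHS]big_mkcond; apply: sum_iota_le => // [q qn|q].
  by case: ifP => // pq; apply: le.
by case: ifP => // /ge0.
Qed.

End IotaSums.

(** * Effect of a new link on utility *)

Section Utility.

Variables (R : realFieldType) (b : nat -> R) (c gamma : R).
Hypothesis hb_dec : forall i : nat, (0 < i)%N -> b i.+1 < b i.
Hypothesis hb_pos : forall i : nat, (0 < i)%N -> 0 < b i.
Hypothesis hgamma0 : 0 <= gamma.
Hypothesis hgamma1 : gamma < 1.

(** Indirect benefit from [w] after the toll. Direct neighbours give zero here, their benefit being
    in the degree term. *)
Definition net_benefit (g : graph) (n j w : nat) : R :=
  if conn g n j w && (1 < dist g n j w)%N
  then (1 - gamma * (ness g n j w != 0%N)%:R) * b (dist g n j w) else 0.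

Definition rent (g : graph) (n j p q : nat) : R :=
  if essential g n j p q
  then gamma / (ness g n p q)%:R * 2 * b (dist g n p q) else 0.

(** The benefit and toll sums merge into one because nodes at distance at most 1 have no essential
    node between them, so no toll is paid there. *)
Lemma utilE (g : graph) (n j : nat) : util b c gamma g n j =
  (deg g n j)%:R * (b 1%N - c) + \sum_(w <- iota 0 n) net_benefit g n j w
  + \sum_(p <- iota 0 n) \sum_(q <- iota 0 n | (p < q)%N) rent g n j p q.
Proof.
rewrite /util; congr (_ + _); last by apply: eq_bigr => p _; rewrite big_mkcondr.
rewrite -addrA; congr (_ + _).
rewrite [X in X - _]big_mkcond [X in _ - X]big_mkcond -sumrB.
apply: eq_bigr => w _; rewrite /net_benefit; case cjw: (conn g n j w) => /=.
  case: ltnP => [_|/(ness_adj cjw) ->]; last by rewrite subr0.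
  by case: (_ != _) => /=; ring.
by rewrite subr0.
Qed.

Lemma benefit_anti (i j : nat) : (0 < i)%N -> (i <= j)%N -> b j <= b i.
Proof.
move=> i0 /subnKC <-; elim: (j - i)%N => [|k IH]; first by rewrite addn0.
by rewrite addnS; apply: le_trans IH; apply/ltW/hb_dec; rewrite addn_gt0 i0.
Qed.


Lemma toll_factor (nz : bool) :
  [/\ 0 < 1 - gamma * nz%:R, 1 - gamma <= 1 - gamma * nz%:R
    & 1 - gamma * nz%:R <= 1].
Proof. by have := hgamma0; have := hgamma1; case: nz => /= *; split; lra. Qed.

Lemma net_benefit_ge0 (g : graph) (n j w : nat) : 0 <= net_benefit g n j w.
Proof.
rewrite /net_benefit; case: ifP => // /andP[_ d1].
have bd := hb_pos (ltnW d1).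
by apply: mulr_ge0 _ (ltW bd); have [/ltW] := toll_factor (ness g n j w != 0%N).
Qed.

Lemma rent_ge0 (g : graph) (n j p q : nat) : p != q -> 0 <= rent g n j p q.
Proof.
move=> pq; rewrite /rent; case: ifP => // /and5P[_ _ _ cpq _].
have bd := ltW (hb_pos (dist_gt0 pq cpq)).
by rewrite !mulr_ge0 // invr_ge0 ler0n.
Qed.

Lemma net_benefit_term_le (nz nz' : bool) (d d' : nat) :
  (0 < d')%N -> (d' <= d)%N -> (nz' -> nz) ->
  (1 - gamma * nz%:R) * b d <= (1 - gamma * nz'%:R) * b d'.
Proof.
move=> d'0 d'd imp; have d0 := leq_trans d'0 d'd.
have ? := hb_pos d0; have ? := benefit_anti d'0 d'd.
apply: ler_pM => //; try exact: ltW.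
  by have [/ltW] := toll_factor nz.
case: nz' imp => [->//|_]; rewrite mulr0 subr0.
by have [] := toll_factor nz.
Qed.

Lemma rent_term_le (m m' d d' : nat) :
  (0 < d')%N -> (d' <= d)%N -> (0 < m')%N -> (m' <= m)%N ->
  gamma / m%:R * 2 * b d <= gamma / m'%:R * 2 * b d'.
Proof.
move=> d'0 d'd m'0 m'm; have d0 := leq_trans d'0 d'd.
have ? := hb_pos d0; have ? := benefit_anti d'0 d'd.
have inv : m%:R^-1 <= m'%:R^-1 :> R.
  by rewrite lef_pV2 ?ler_nat ?posrE ?ltr0n // (leq_trans m'0).
have inv0 : 0 <= m%:R^-1 :> R by rewrite invr_ge0 ler0n.
apply: ler_pM => //; [by rewrite !mulr_ge0|exact: ltW|].
by rewrite ler_wpM2r // ler_wpM2l.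
Qed.

(* Taking n' > n covers the acceptance of a newcomer, who is isolated in g. *)
Lemma util_add_ge (g g' : graph) (n n' x y : nat) :
  (n <= n')%N -> (x < n)%N -> (y < n')%N -> x != y -> ~~ g x y ->
  (forall u w, g u w -> (u < n)%N) ->
  (forall u w, g u w -> g' u w) ->
  (forall u w, u != x -> w != x -> g' u w -> g u w) ->
  (forall w, g' x w = g x w || (w == y)) ->
  (forall w, g x w -> (w < n)%N) ->
  util b c gamma g n x + (b 1%N - c)
    - (if conn g n x y then b (dist g n x y) else 0) <= util b c gamma g' n' x.
Proof.
move=> nn' xn yn' xy ngxy gn sub back nbr gxn.
have iotaE : iota 0 n' = iota 0 n ++ iota n (n' - n) by rewrite -iotaD subnKC.
have mono ok k p q : walk_k ok g n k p q -> walk_k ok g' n' k p q.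
  apply: (@walk_hom ok ok predT g' g n' n id) => // u w oku un _ guw.
  by right; split; rewrite ?(leq_trans un) ?sub.
have cmono p q : conn g n p q -> conn g' n' p q by move/mono/connW.
(* All new links are incident to [x], so walks avoiding [x] are unchanged; this is why [x] keeps
   every pair it is essential for. *)
have avoid k p q : q != x ->
    walk_k (fun w => w != x) g' n' k p q -> walk_k (fun w => w != x) g n k p q.
  move=> qx; apply: (@walk_hom _ _ (fun w => w != x) g g' n n' id) => //.
  by move=> u w ux _ wx /(back _ _ ux wx) guw; right; split=> //; apply: gn guw.
have dmono p q : conn g n p q -> (dist g' n' p q <= dist g n p q)%N.
  by move=> cpq; apply: dist_le (mono _ _ _ _ (walk_dist cpq)).
have ess z p q : conn g n p q -> essential g' n' z p q -> essential g n z p q.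
  move=> cpq /and5P[zn' zp zq _ nw]; rewrite /essential zp zq cpq /=.
  apply/andP; split; last by apply: contra nw => /mono/walk_sat.
  (* A node outside the old range cannot be essential, since no walk of [g] passes through it. *)
  rewrite ltnNge; apply: contra nw => nz.
  apply: (@walk_sat _ _ _ n); apply: mono.
  apply: (@walk_hom _ predT predT g g n n id) cpq => // u w _ un _ guw.
  by right; split=> //; rewrite neq_ltn (leq_trans un).
have nmono p q : conn g n p q -> (ness g' n' p q <= ness g n p q)%N.
  move=> cpq; rewrite /ness iotaE count_cat.
  rewrite [X in (_ + X <= _)%N](_ : _ = 0%N) ?addn0.
    by apply: sub_count => z /=; apply: ess.
  rewrite -[RHS](count_pred0 (iota n (n' - n))); apply: eq_in_count => z.
  rewrite mem_iota => /andP[nz _]; apply/negP.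
  by move/(ess _ _ _ cpq)/andP=> [zn _]; rewrite ltnNge nz in zn.
have rmono p q : essential g n x p q -> essential g' n' x p q.
  case/and5P=> _ xp xq cpq nw.
  rewrite /essential (leq_trans xn nn') xp xq cmono //=.
  by apply: contra nw => /avoid; rewrite eq_sym => /(_ xq)/walk_sat.
(* [L] bounds what [x] forgoes: its indirect benefit from [y], which is now counted through the
   degree. *)
set L := (if _ then _ else _).
have L0 : 0 <= L.
  by rewrite /L; case: ifP => // cxy; apply/ltW/hb_pos/dist_gt0.
have degE : deg g' n' x = (deg g n x).+1.
  have -> : deg g n x = deg g n' x.
    rewrite /deg iotaE count_cat.
    rewrite [X in (_ = _ + X)%N](_ : _ = 0%N) ?addn0 //.
    rewrite -[RHS](count_pred0 (iota n (n' - n))); apply: eq_in_count => z.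
    rewrite mem_iota => /andP[nz _]; apply/negP => /gxn.
    by rewrite ltnNge nz.
  exact: (deg_add yn' ngxy nbr).
have leM : \sum_(p <- iota 0 n) \sum_(q <- iota 0 n | (p < q)%N) rent g n x p q <=
    \sum_(p <- iota 0 n') \sum_(q <- iota 0 n' | (p < q)%N) rent g' n' x p q.
  apply: sum_pairs_le => // [p q pq qn|p q pq].
    2: by apply: rent_ge0; rewrite neq_ltn pq.
  rewrite /rent; case: ifP => [e|_]; last by apply: rent_ge0; rewrite neq_ltn pq.
  rewrite rmono //; case/and5P: (e) => _ _ _ cpq _.
  apply: rent_term_le; rewrite ?dmono ?nmono ?dist_gt0 ?cmono //.
    by rewrite neq_ltn pq.
  exact: ness_essential (rmono _ _ e).
have leN : \sum_(w <- iota 0 n) net_benefit g n x w <=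
    \sum_(w <- iota 0 n') net_benefit g' n' x w + L.
  have -> : \sum_(w <- iota 0 n') net_benefit g' n' x w + L = 
    \sum_(w <- iota 0 n') (net_benefit g' n' x w + (w == y)%:R * L).
    by rewrite big_split /= sum_iota_delta.
  apply: (sum_iota_le nn') => [w wn|w]; last first.
    by apply: addr_ge0 (net_benefit_ge0 _ _ _ _) _; rewrite mulr_ge0 ?ler0n.
  have nb0 := net_benefit_ge0 g' n' x w.
  rewrite {1}/net_benefit; case: ifP => [/andP[cxw d1]|_]; last first.
    by rewrite addr_ge0 ?mulr_ge0 ?ler0n.
  case: (eqVneq w y) => [wy|wy] /=; rewrite ?mul1r ?mul0r ?addr0.
    apply: le_trans (_ : L <= _); last by rewrite lerDr.
    rewrite /L -wy cxw; have bd := hb_pos (ltnW d1).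
    by apply: ler_piMl (ltW bd) _; have [] := toll_factor (ness g n x w != 0%N).
  have d1' : (1 < dist g' n' x w)%N.
    rewrite dist_gt1 ?cmono ?(leq_trans xn) // nbr (negPf wy) orbF.
    by rewrite dist_gt1 in d1.
  rewrite /net_benefit cmono // d1' /=; apply: net_benefit_term_le.
  - exact: ltnW.
  - exact: dmono.
  - by rewrite -!lt0n => h; apply: leq_trans h (nmono _ _ cxw).
by have := lerD leM leN; rewrite !utilE degE -natr1; lra.
Qed.

(** Without a walk of length 2, [x] and [y] are disconnected or at distance at least 3, so the
    forgone benefit is at most [b 3], less than the direct gain [b 1 - c]. *)
Lemma util_add_gt (g g' : graph) (n n' x y : nat) :
  b 3%N < b 1%N - c ->
  (n <= n')%N -> (x < n)%N -> (y < n')%N -> x != y -> ~~ walk_k predT g n 2 x y ->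
  (forall u w, g u w -> (u < n)%N) ->
  (forall u w, g u w -> g' u w) ->
  (forall u w, u != x -> w != x -> g' u w -> g u w) ->
  (forall w, g' x w = g x w || (w == y)) ->
  (forall w, g x w -> (w < n)%N) ->
  util b c gamma g n x < util b c gamma g' n' x.
Proof.
move=> cb nn' xn yn' xy nw gn sub back nbr gxn.
have ngxy : ~~ g x y.
  apply: contra nw => gxy; apply: (@walk_mono _ _ _ 1) => //.
  by rewrite walk1 xn gxy orbT.
have := util_add_ge nn' xn yn' xy ngxy gn sub back nbr gxn.
have b3 := hb_pos (isT : (0 < 3)%N); case: ifP => [cxy|_]; last by lra.
have d3 : (2 < dist g n x y)%N by rewrite ltnNge dist_leE.
by have := benefit_anti (isT : (0 < 3)%N) d3; lra.
Qed.

(** * A link between two nodes with nested neighbourhoods *)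

Section RedundantLink.

Variables (g g' : graph) (n x y t q0 : nat).
Hypothesis gC : symmetric g.
Hypothesis gn : forall u w, g u w -> (u < n)%N.
Hypotheses (xn : (x < n)%N) (yn : (y < n)%N) (xy : x != y) (ngxy : ~~ g x y).
Hypothesis g'E : forall u w,
  g' u w = [|| g u w, (u == x) && (w == y) | (u == y) && (w == x)].
Hypothesis nest : forall w, g x w -> g y w.
Hypothesis gxt : g x t.
(** Only pairs [{x, q}] separated by [y] can bring [y] a higher rent after the link; this leaves at
    most one of them. *)
Hypothesis cut : forall q, (q < n)%N -> q != x -> q != y ->
  ~~ walk_k (fun w => w != y) g n n x q -> q = q0 /\ g y q.

Let sub u w : g u w -> g' u w. Proof. by rewrite g'E => ->. Qed.

Let g'C : symmetric g'.
Proof.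
move=> u w; rewrite !g'E gC; congr (_ || _); rewrite orbC.
by congr (_ || _); rewrite andbC.
Qed.

Let g'n u w : g' u w -> (u < n)%N.
Proof. by rewrite g'E => /or3P[/gn // | /andP[/eqP-> _] | /andP[/eqP-> _]]. Qed.

Let mono (ok : pred nat) k p q : walk_k ok g n k p q -> walk_k ok g' n k p q.
Proof.
apply: (@walk_hom ok ok predT g' g n n id) => // u w oku un _ guw.
by right; split; rewrite ?sub.
Qed.

(* Redirecting x to y folds g' onto g. *)
Let fold (ok : pred nat) k p q : (ok x -> ok y) -> p != x -> q != x ->
  walk_k ok g' n k p q -> walk_k ok g n k p q.
Proof.
pose f w := if w == x then y else w.
have fE w : w != x -> f w = w by rewrite /f => /negPf->.
have fx : f x = y by rewrite /f eqxx.
move=> okxy px qx wpq; rewrite -(fE p) // -(fE q) //.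
apply: (@walk_hom ok ok predT g g' n n f) wpq => // u w oku un _.
(* The new link collapses to the single node [y], and an old link from [x] becomes one from [y] by
   [nest]. *)
rewrite g'E; case: (eqVneq u x) => [ux|ux]; case: (eqVneq w x) => [wx|wx].
- by left; rewrite ux wx.
- rewrite ux fx (fE w) //= (negPf xy) orbF => /orP[/nest gyw|/eqP->]; last by left.
  by right; rewrite -ux in okxy; split=> //; apply: okxy.
- rewrite wx fx (fE u) //= andbT => /orP[|/eqP->]; last by left.
  by rewrite gC => /nest; rewrite gC; right.
- by rewrite !fE // !andbF /= orbF => guw; right.
Qed.

Let wk k p q : p != x -> q != x -> walk_k predT g' n k p q = walk_k predT g n k p q.
Proof. by move=> px qx; apply/idP/idP; [apply: fold|apply: mono]. Qed.

Let dist_fold p q : p != x -> q != x -> dist g' n p q = dist g n p q.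
Proof. by move=> px qx; apply: eq_find => k; apply: wk. Qed.

Let avoid k p q : q != y ->
  walk_k (fun w => w != y) g' n k p q -> walk_k (fun w => w != y) g n k p q.
Proof.
move=> qy; apply: (@walk_hom _ _ (fun w => w != y) g g' n n id) => //.
move=> u w uy un wy; rewrite g'E (negPf uy) (negPf wy) !andbF /= orbF => guw.
by right.
Qed.

Let ess z p q : p != x -> q != x -> essential g n z p q -> essential g' n z p q.
Proof.
move=> px qx /and5P[zn zp zq cpq nw]; rewrite /essential zn zp zq /=.
rewrite /conn wk // -/(conn g n p q) cpq /=; apply: contra nw.
(* Folding may introduce visits to [y], so it serves only for [z] other than [y]; a walk avoiding
   [y] does not use the new link at all. *)
case: (eqVneq z y) => [zy|zy]; last by apply: fold => //= _; rewrite eq_sym.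
by rewrite zy in zq *; apply: avoid; rewrite eq_sym.
Qed.

Let walk_xy : walk_k predT g n 2 x y.
Proof.
have gty : g t y by rewrite gC nest.
by apply: (@walk_cons _ _ _ 1 x t) => //; rewrite walk1 (gn gty) gty orbT.
Qed.

(** Before the link, [x] is at distance 2 from [y] through [t], and the toll takes at most the
    fraction [gamma]; afterwards the indirect benefit is zero. *)
Let net_x :
  net_benefit g' n y x + (1 - gamma) * b 2%N <= net_benefit g n y x.
Proof.
have cyx : conn g n y x by rewrite conn_sym //; apply: connW walk_xy.
have d2 : dist g n y x = 2%N.
  apply/eqP; rewrite eqn_leq dist_gt1 // eq_sym xy gC ngxy andbT.
  by rewrite dist_sym // dist_le.
have -> : net_benefit g' n y x = 0.
  rewrite /net_benefit ltnNge dist_le ?andbF //.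
  by rewrite walk1 g'E yn !eqxx !orbT.
rewrite add0r /net_benefit cyx d2 /=; apply: ler_wpM2r.
  exact/ltW/hb_pos.
by have [] := toll_factor (ness g n y x != 0%N).
Qed.

(** Distances away from [x] do not change and no essential node is lost, so the toll cannot
    disappear. *)
Let net_other w : w != x -> net_benefit g' n y w <= net_benefit g n y w.
Proof.
move=> wx; have yx : y != x by rewrite eq_sym.
rewrite /net_benefit /conn wk // dist_fold //; case: ifP => // /andP[cyw d1].
apply: net_benefit_term_le => //; first exact: ltnW.
by rewrite !ness_gt0 => /hasP[z zn /ess e]; apply/hasP; exists z => //; apply: e.
Qed.

Let rent_other p q : p != q -> p != x -> q != x ->
  rent g' n y p q <= rent g n y p q.
Proof.
move=> pq px qx; rewrite {1}/rent; case: ifP => [e'|_]; last exact: rent_ge0.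
case/and5P: (e') => _ yp yq; rewrite /conn wk // => cpq nw.
have e : essential g n y p q.
  by rewrite /essential yn yp yq /conn cpq; apply: contra nw => /mono.
rewrite /rent e dist_fold //; apply: rent_term_le => //.
- exact: dist_gt0.
- exact: ness_essential e.
- by apply: sub_count => z; apply: ess.
Qed.

(** In [g] the walk [x], [t], [y], [r] gives distance at most 3 and at most two essential nodes, so
    the old rent is at least [gamma * b 3]. The new distance is at least 2, so the new rent is at
    most [gamma * 2 * b 2]. *)
Let rent_x r : (r < n)%N -> r != x -> essential g' n y x r ->
  r = q0 /\ rent g' n y x r <= rent g n y x r + gamma * (2 * b 2%N - b 3%N).
Proof.
move=> rn rx e'; case/and5P: (e') => _ yx yr cxr' nw'.
have nw : ~~ walk_k (fun w => w != y) g n n x r by apply: contra nw' => /mono.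
have ry : r != y by rewrite eq_sym.
have [rq0 gyr] := cut rn rx ry nw; split=> //.
have ngxr : ~~ g x r.
  apply: contra nw => gxr; apply: (@walk_sat _ _ _ 1).
  by rewrite walk1 xn gxr xy orbT.
have xr : x != r by rewrite eq_sym.
have gyt : g y t := nest gxt.
have tn : (t < n)%N by apply: (gn (w := y)); rewrite gC.
have path3 (ok : pred nat) : ok x -> ok t -> ok y -> walk_k ok g n 3 x r.
  move=> okx okt oky; apply: (walk_cons okx xn gxt).
  apply: (@walk_cons _ _ _ _ _ y) => //; first by rewrite gC.
  by rewrite walk1 oky yn gyr orbT.
have cxr : conn g n x r by apply: connW (path3 predT _ _ _).
have e : essential g n y x r by rewrite /essential yn yx yr cxr.
have ness2 : (ness g n x r <= 2)%N.
  rewrite /ness -size_filter; apply: (@uniq_leq_size _ _ [:: t; y]).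
    by rewrite filter_uniq ?iota_uniq.
  move=> z; rewrite mem_filter => /andP[/and5P[_ zx zr _ nz] _].
  rewrite !inE; apply: contraR nz; rewrite negb_or => /andP[zt zy].
  by apply: (@walk_sat _ _ _ 3); apply: path3; rewrite eq_sym.
rewrite /rent e' e.
have le' : gamma / (ness g' n x r)%:R * 2 * b (dist g' n x r) <= gamma / 1%:R * 2 * b 2%N.
  apply: rent_term_le => //; last exact: ness_essential e'.
  rewrite dist_gt1 // xr g'E (negPf ngxr) (negPf ry) (negPf rx).
  by rewrite !andbF.
have le : gamma / 2%:R * 2 * b 3%N <= gamma / (ness g n x r)%:R * 2 * b (dist g n x r).
  apply: rent_term_le => //.
  - exact: dist_gt0.
  - exact: dist_le (path3 predT _ _ _).
  - exact: ness_essential e.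
apply: le_trans le' _; apply: le_trans (lerD le (lexx _)).
by rewrite le_eqVlt; apply/orP; left; apply/eqP; field.
Qed.

(* Besides b 2 - b 1 for the direct benefit, y gains at most gamma * b 2 on its own
   toll to t, and gamma * (2 * b 2 - b 3) on the pair {x, q0}, from which t
   possibly took its share. *)
Lemma util_redundant_lt :
  b 1%N - b 2%N + gamma * (3 * b 2%N - b 3%N) < c ->
  util b c gamma g' n y < util b c gamma g n y.
Proof.
move=> hc.
have K0 : 0 <= gamma * (2 * b 2%N - b 3%N).
  apply: mulr_ge0 => //; have := hb_dec (isT : (0 < 2)%N).
  by have := hb_pos (isT : (0 < 2)%N); lra.
set K := gamma * _ in K0.
have leN : \sum_(w <- iota 0 n) net_benefit g' n y w + (1 - gamma) * b 2%N <=
    \sum_(w <- iota 0 n) net_benefit g n y w.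
  rewrite -(sum_iota_delta ((1 - gamma) * b 2%N) xn) -big_split /=.
  apply: ler_sum => w _; case: (eqVneq w x) => [->|wx]; first by rewrite mul1r net_x.
  by rewrite mul0r addr0 net_other.
have leM : \sum_(p <- iota 0 n) \sum_(q <- iota 0 n | (p < q)%N) rent g' n y p q <=
    \sum_(p <- iota 0 n) \sum_(q <- iota 0 n | (p < q)%N) rent g n y p q + K.
  (* Rents are summed over increasing pairs, so the exceptional pair enters as minimum and maximum
     of [x] and [q0]. *)
  have le2 := sum_pairs_delta_le n (minn x q0) (maxn x q0) K0.
  apply: le_trans (lerD (lexx _) le2); rewrite -big_split /=.
  under [leRHS]eq_bigr do rewrite -big_split /=.
  have dge p q : 0 <= (p == minn x q0)%:R * ((q == maxn x q0)%:R * K).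
    by apply: mulr_ge0 => //; apply: mulr_ge0.
  apply: sum_pairs_le => // p q pq; have npq : p != q by rewrite neq_ltn pq.
    2: by rewrite addr_ge0 ?rent_ge0.
  move=> qn; have pn := ltn_trans pq qn.
  have rentC r s : rent g n y r s = rent g n y s r.
    by rewrite /rent essential_sym // ness_sym // dist_sym.
  have rentC' r s : rent g' n y r s = rent g' n y s r.
    by rewrite /rent essential_sym // ness_sym // dist_sym.
  have [px|px] := eqVneq p x; last have [qx|qx] := eqVneq q x.
  - case e': (essential g' n y p q); last by rewrite {1}/rent e' addr_ge0 ?rent_ge0.
    have qx : q != x by rewrite -px eq_sym.
    move: (e'); rewrite px => /(rent_x qn qx)[qq0].
    by rewrite -qq0 -px (minn_idPl (ltnW pq)) (maxn_idPr (ltnW pq)) !eqxx !mul1r.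
  - case e': (essential g' n y p q); last by rewrite {1}/rent e' addr_ge0 ?rent_ge0.
    move: (e'); rewrite qx essential_sym // => /(rent_x pn px)[pq0].
    rewrite rentC' (rentC p).
    by rewrite -pq0 -qx (minn_idPr (ltnW pq)) (maxn_idPl (ltnW pq)) !eqxx !mul1r.
  - by apply: le_trans (rent_other npq px qx) _; rewrite lerDl.
have degE : deg g' n y = (deg g n y).+1.
  apply: (deg_add xn); first by rewrite gC.
  by move=> w; rewrite g'E eqxx /= [y == x]eq_sym (negPf xy).
(* The change is at most [(b 1 - c) - (1 - gamma) * b 2 + gamma * (2 * b 2 - b 3)], negative by the
   lower bound on [c]. *)
by rewrite !utilE degE -natr1; have := lerD leN leM; rewrite /K; lra.
Qed.

End RedundantLink.

End Utility.

(** * Counting nodes and halving *)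

Section Counting.

Lemma count_exists (P : pred nat) (n : nat) (s : seq nat) :
  (size s < count P (iota 0 n))%N -> exists z, [/\ (z < n)%N, P z & z \notin s].
Proof.
rewrite ltnNge => /negP h.
have [/hasP[z]|/hasPn nz] := boolP (has (fun z => P z && (z \notin s)) (iota 0 n)).
  by rewrite mem_iota => zn /andP[]; exists z.
case: h; rewrite -size_filter; apply: uniq_leq_size.
  by rewrite filter_uniq ?iota_uniq.
move=> z; rewrite mem_filter => /andP[Pz /nz]; rewrite Pz /=.
by move/negPn.
Qed.

Lemma count_ge_uniq (P : pred nat) (n : nat) (s : seq nat) :
  uniq s -> (forall z, z \in s -> (z < n)%N /\ P z) -> (size s <= count P (iota 0 n))%N.
Proof.
move=> us h; rewrite -size_filter; apply: uniq_leq_size => // z /h[zn Pz].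
by rewrite mem_filter Pz mem_iota.
Qed.

Lemma count_complement (P : pred nat) (n : nat) :
  count (fun z => ~~ P z) (iota 0 n) = (n - count P (iota 0 n))%N.
Proof.
have := count_predC P (iota 0 n); rewrite size_iota => e.
by rewrite -{2}e addKn.
Qed.

Lemma half_leB (n : nat) : (n./2 <= n - n./2)%N.
Proof. by lia. Qed.

Lemma half_ltB (n : nat) : (0 < n)%N -> (0 < n - n./2)%N.
Proof. by lia. Qed.

Lemma odd_halfB (n : nat) : odd n -> (n - n./2 = n./2.+1)%N.
Proof. by lia. Qed.

End Counting.

(** * The invariant, and distances in bipartite networks *)

(** [at_link] presupposes a node in [A] because the initial one-node network has [A] empty and [v]
    isolated. *)
Record almost_turan (n : nat) (g : graph) (A : pred nat) (v : nat) : Prop := {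
  at_v : (v < n)%N;
  at_vA : ~~ A v;
  at_size : count A (iota 0 n) = n./2;
  at_sub : forall x y, g x y -> [/\ (x < n)%N, (y < n)%N & A x != A y];
  at_sym : symmetric g;
  at_full : forall x y, (x < n)%N -> (y < n)%N -> x != v -> y != v ->
    A x != A y -> g x y;
  at_link : forall a, (a < n)%N -> A a -> exists s, g v s }.

(** Two steps lead back to the starting side. *)
Lemma bipartite_no_walk2 (g : graph) (n x y : nat) (A : pred nat) :
  (forall u w, g u w -> A u != A w) -> A x != A y -> ~~ g x y ->
  ~~ walk_k predT g n 2 x y.
Proof.
move=> gA Axy ngxy; apply/negP.
have xy : x != y by apply: contraNneq Axy => ->.
rewrite walkS walk1 (negPf xy) (negPf ngxy) andbF /= => /hasP[w _].
case/andP=> /orP[/eqP<-|/hasP[u _ /andP[/eqP<- gxw]] gwy].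
  by rewrite (negPf ngxy).
move: (gA _ _ gxw) (gA _ _ gwy) Axy.
by case: (A x); case: (A w); case: (A y).
Qed.

(** * Moves in the formation process *)

Section Dynamics.

Variables (R : realFieldType) (b : nat -> R) (c gamma c0 : R).
Hypothesis hb_dec : forall i : nat, (0 < i)%N -> b i.+1 < b i.
Hypothesis hb_pos : forall i : nat, (0 < i)%N -> 0 < b i.
Hypothesis hgamma0 : 0 <= gamma.
Hypothesis hgamma1 : gamma < 1.
Hypothesis hc_lo : b 1%N - b 2%N + gamma * (3 * b 2%N - b 3%N) < c.
Hypothesis hc_hi : c < b 1%N - b 3%N.
Hypothesis hc0_lo : (1 - gamma) * (b 2%N - b 3%N) < c0.

Local Notation util := (util b c gamma).

Let hcb : b 3%N < b 1%N - c. Proof. by have := hc_hi; lra. Qed.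

(** Read the deletion backwards: restoring the link joins two nodes of opposite sides that are not
    adjacent, hence not within distance 2. *)
Lemma util_del_lt (g : graph) (n i j : nat) (A : pred nat) :
  symmetric g -> (forall x y, g x y -> [/\ (x < n)%N, (y < n)%N & A x != A y]) ->
  g i j -> util (del_link g i j) n i < util g n i.
Proof.
move=> gC gA gij; have [iltn jltn Aij] := gA _ _ gij.
have ij : i != j by apply: contraNneq Aij => ->.
have sub u w : del_link g i j u w -> g u w by case/andP.
apply: (@util_add_gt _ b c gamma _ _ _ _ (del_link g i j) g n n i j) => //.
- apply: (@bipartite_no_walk2 _ _ _ _ A) => // [u w /sub/gA[]//|].
  by rewrite /del_link !eqxx andbF.
- by move=> u w /sub/gA[].
- by move=> u w ui wi guw; rewrite /del_link guw (negPf ui) (negPf wi) andbF.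
- move=> w; rewrite /del_link eqxx (negPf ij) /= orbF.
  by case: eqP => [->|_]; rewrite ?andbT ?orbF // gij.
- by move=> w /sub/gA[].
Qed.

(** * New links in a network satisfying the invariant *)

Section Position.

Variables (n : nat) (g : graph) (A : pred nat) (v : nat).
Hypothesis gT : almost_turan n g A v.

Let gn u w : g u w -> (u < n)%N. Proof. by case/(at_sub gT). Qed.
Let gC : symmetric g := at_sym gT.

Let Anv a : A a -> a != v.
Proof. by apply: contraTneq => ->; apply: at_vA gT. Qed.

(** The equation for [g'] is symmetric in the two ends up to reordering, so the statement applies to
    either end of one [add_link]. *)
Lemma util_cross_lt (g' : graph) (x y : nat) :
  (x < n)%N -> (y < n)%N -> A x != A y -> ~~ g x y ->
  (forall u w, g' u w = [|| g u w, (u == x) && (w == y) | (u == y) && (w == x)]) ->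
  util g n x < util g' n x.
Proof.
move=> xn yn Axy ngxy g'E; have xy : x != y by apply: contraNneq Axy => ->.
apply: (@util_add_gt _ b c gamma _ _ _ _ g g' n n x y) => //.
- by apply: (@bipartite_no_walk2 _ _ _ _ A) => // u w /(at_sub gT)[].
- by move=> u w; rewrite g'E => ->.
- by move=> u w ux wx; rewrite g'E (negPf ux) (negPf wx) andbF /= orbF.
- by move=> w; rewrite g'E eqxx (negPf xy) orbF.
- by move=> w /(at_sub gT)[].
Qed.

(** The work lies in checking that removing [y] cuts [x] off from at most one other node, and that
    this node is a neighbour of [y]. *)
Lemma util_same_side_lt (g' : graph) (x y : nat) :
  (x < n)%N -> (y < n)%N -> x != y -> A x = A y -> y != v ->
  (forall w, g x w -> g y w) ->
  (forall u w, g' u w = [|| g u w, (u == x) && (w == y) | (u == y) && (w == x)]) ->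
  util g' n y < util g n y.
Proof.
move=> xn yn xy Axy yv nest g'E.
have ngxy : ~~ g x y by apply/negP => /(at_sub gT)[_ _]; rewrite Axy eqxx.
have n2 : (2 <= n)%N.
  rewrite -[leqRHS](size_iota 0) -(count_predT (iota 0 n)).
  apply: (count_ge_uniq (s := [:: x; y])); first by rewrite /= inE xy.
  by move=> z; rewrite !inE => /orP[] /eqP->.
have [s gvs] : exists s, g v s.
  have [a [aN Aa _]] : exists a, [/\ (a < n)%N, A a & a \notin [::]].
    by apply: count_exists; rewrite (at_size gT) half_gt0.
  exact: (at_link gT) aN Aa.
have [_ sn] := at_sub gT gvs; rewrite (negPf (at_vA gT)) => As.
have {}As : A s by case: (A s) As.
have sv := Anv As; have gsv : g s v by rewrite gC.
pose avoid := walk_k (fun w => w != y) g n.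
have w1 p q : p != y -> g p q -> avoid 1%N p q.
  by move=> py gpq; rewrite /avoid walk1 py gpq (gn gpq) orbT.
have wS k p r q : p != y -> g p r -> avoid k r q -> avoid k.+1 p q.
  by move=> py gpr; apply: walk_cons py (gn gpr) gpr.
have sat k p q : avoid k p q -> avoid n p q by apply: walk_sat.
have [Ay|nAy] := boolP (A y).
  have Ax : A x by rewrite Axy.
  (* Both [x] and [y] lie in [A], so the other side has at least two nodes; a node [e] other than
     [v] is linked to all of [A] and serves as the common neighbour. *)
  have [e [en nAe ev]] : exists e, [/\ (e < n)%N, ~~ A e & e \notin [:: v]].
    apply: count_exists; rewrite count_complement (at_size gT) /=.
    have : (2 <= count A (iota 0 n))%N.
      apply: (count_ge_uniq (s := [:: x; y])); first by rewrite /= inE xy.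
      by move=> z; rewrite !inE => /orP[] /eqP->.
    by rewrite (at_size gT) => /leq_trans; apply; apply: half_leB.
  rewrite inE in ev.
  have toe a : (a < n)%N -> A a -> g a e.
    by move=> an Aa; apply: (at_full gT) => //; [exact: Anv|rewrite Aa (negPf nAe)].
  have ey : e != y by apply: contraNneq nAe => ->.
  apply: (@util_redundant_lt _ b c gamma _ _ _ _ g g' n x y e v) => //; first exact: toe.
  move=> q qn qx qy; rewrite -/(avoid n x q) => nw.
  have [qv|qv] := eqVneq q v; last first.
    case/negP: nw; have [Aq|nAq] := boolP (A q).
      by apply: (sat 2); apply: (wS _ _ e _); rewrite ?toe // w1 // gC toe.
    apply: (sat 1%N); apply: w1 => //; apply: (at_full gT) => //.
      exact: Anv.
    by rewrite Ax (negPf nAq).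
  (* Only [v] can be cut off, and then its known neighbour [s] is [y] itself: otherwise [v] is
     reached from [x] directly or through [e] and [s]. *)
  split=> //; have [<-|sy] := eqVneq s y; first by rewrite qv.
  case/negP: nw; rewrite qv; have [sx|sx] := eqVneq s x.
    by apply: (sat 1%N); apply: w1; rewrite // -sx.
  apply: (sat 3); apply: (wS _ _ e _); rewrite ?toe //.
  by apply: (wS _ _ s _); rewrite ?(gC e) ?toe // w1.
have nAx : ~~ A x by rewrite Axy.
have sy : s != y by apply: contraTneq As => ->.
have tos q : (q < n)%N -> ~~ A q -> g q s.
  move=> qn nAq; have [->//|qv] := eqVneq q v.
  by apply: (at_full gT) => //; rewrite As (negPf nAq).
pose sep q := [&& q != x, q != y & ~~ avoid n x q].
(* Nodes outside [A] are reached through [s], which is linked to all of them; and if [x] were not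
   [v], it would be linked to all of [A]. *)
have sepA q : (q < n)%N -> sep q -> [/\ A q, x = v & q != s].
  move=> qn /and3P[qx qy nw].
  have Aq : A q.
    apply: contraR nw => nAq; apply: (sat 2).
    by apply: (wS _ _ s _); rewrite ?tos // w1 // gC tos.
  have ngxq : ~~ g x q by apply: contra nw => gxq; apply: (sat 1%N); apply: w1.
  split=> //; last by apply: contraNneq ngxq => ->; apply: tos.
  apply/eqP; apply: contraR ngxq => xv; apply: (at_full gT) => //; first exact: Anv.
  by rewrite Aq (negPf nAx).
have [/hasP[q0 q0n sep0]|/hasPn nsep] := boolP (has sep (iota 0 n)); last first.
  (* Nothing is cut off here, so [0] is an arbitrary value for [q0]. *)
  apply: (@util_redundant_lt _ b c gamma _ _ _ _ g g' n x y s 0%N) => //; first exact: tos.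
  move=> q qn qx qy; rewrite -/(avoid n x q) => nw.
  have := nsep q; rewrite mem_iota => /(_ qn).
  by rewrite /sep qx qy nw.
rewrite mem_iota in q0n; have [Aq0 xv q0s] := sepA _ q0n sep0.
apply: (@util_redundant_lt _ b c gamma _ _ _ _ g g' n x y s q0) => //; first exact: tos.
move=> q qn qx qy; rewrite -/(avoid n x q) => nw.
have [|Aq _ qs] := sepA q qn; first by rewrite /sep qx qy nw.
have gy a : (a < n)%N -> A a -> g y a.
  by move=> an Aa; apply: (at_full gT) => //; [exact: Anv|rewrite Aa (negPf nAy)].
split; last exact: gy.
apply/eqP; apply: contraR nw => qq0.
(* Two cut-off nodes and [s] make three nodes in [A], hence at least three on the other side; the
   third, [e], is neither [v] nor [y] and gives the walk [x], [s], [e], [q]. *)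
have A3 : (3 <= count A (iota 0 n))%N.
  apply: (count_ge_uniq (s := [:: q; q0; s])).
    by rewrite /= !inE negb_or qq0 qs q0s.
  by move=> z; rewrite !inE => /or3P[] /eqP->.
have [e [en nAe]] : exists e, [/\ (e < n)%N, ~~ A e & e \notin [:: v; y]].
  apply: count_exists; rewrite count_complement; rewrite (at_size gT) in A3 *.
  exact: leq_trans A3 (half_leB n).
rewrite !inE negb_or => /andP[ev ey].
apply: (sat 3); apply: (wS _ _ s _); rewrite ?tos //.
apply: (wS _ _ e _) => //; first by rewrite gC tos.
apply: w1 => //; apply: (at_full gT) => //; first exact: Anv.
by rewrite Aq (negPf nAe).
Qed.

(* Neighbourhoods on one side are nested; the endpoint with the larger one loses. *)
Lemma same_side_refused (g' : graph) (x y : nat) :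
  (x < n)%N -> (y < n)%N -> x != y -> A x = A y ->
  (forall u w, g' u w = [|| g u w, (u == x) && (w == y) | (u == y) && (w == x)]) ->
  util g' n x < util g n x \/ util g' n y < util g n y.
Proof.
move=> xn yn xy Axy g'E.
have g'E' u w : g' u w = [|| g u w, (u == y) && (w == x) | (u == x) && (w == y)].
  by rewrite g'E; congr (_ || _); rewrite orbC.
have yx : y != x by rewrite eq_sym.
have [Ax|nAx] := boolP (A x).
  have Ay : A y by rewrite -Axy.
  have nested p q : (q < n)%N -> A p -> A q -> (g v p -> g v q) ->
      forall w, g p w -> g q w.
    move=> qn Ap Aq imp w gpw; have [_ wn Apw] := at_sub gT gpw.
    have [wv|wv] := eqVneq w v; first by rewrite wv gC imp // gC -wv.
    by apply: (at_full gT) => //; [exact: Anv|rewrite Aq -Ap].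
  (* Neighbourhoods of nodes in [A] can differ only at [v], so adjacency of [x] to [v] decides which
     one is larger. *)
  have [gvx|ngvx] := boolP (g v x).
    by left; apply: util_same_side_lt g'E' => //; [exact: Anv|exact: nested].
  right; apply: util_same_side_lt g'E => //; first exact: Anv.
  by apply: nested => //; rewrite (negPf ngvx).
have nAy : ~~ A y by rewrite -Axy.
have nested p q : (q < n)%N -> A p = A q -> ~~ A q -> q != v ->
    forall w, g p w -> g q w.
  move=> qn Apq nAq qv w gpw; have [_ wn] := at_sub gT gpw; rewrite Apq => Aqw.
  apply: (at_full gT) => //; apply: Anv.
  by move: Aqw; rewrite (negPf nAq); case: (A w).
have [xv|xv] := eqVneq x v.
  have yv : y != v by rewrite -xv.
  by right; apply: util_same_side_lt g'E => //; apply: nested.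
by left; apply: util_same_side_lt g'E' => //; apply: nested.
Qed.

Lemma stable_complete : pairwise_stable b c gamma n g ->
  forall x y, (x < n)%N -> (y < n)%N -> g x y = (A x != A y).
Proof.
case=> _ stable x y xn yn; apply/idP/idP => [/(at_sub gT)[]//|Axy].
apply/negPn/negP => ngxy.
have xy : x != y by apply: contraNneq Axy => ->.
have addE u w : add_link g x y u w =
    [|| g u w, (u == x) && (w == y) | (u == y) && (w == x)] by [].
have addE' u w : add_link g x y u w =
    [|| g u w, (u == y) && (w == x) | (u == x) && (w == y)].
  by rewrite addE; congr (_ || _); rewrite orbC.
have ux := util_cross_lt xn yn Axy ngxy addE.
have uy : util g n y < util (add_link g x y) n y.
  by apply: util_cross_lt addE' => //; rewrite 1?eq_sym 1?gC.
by have := stable x y xn yn xy ngxy ux; rewrite ltNge ltW.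
Qed.

End Position.

(** * The newcomer's choice of its first link *)

(** The newcomer is a leaf at [t]: it earns no rent, and [t] is essential for all its indirect
    benefits. These come from distance 2 for neighbours of [t] and distance 3 for the rest. *)
Lemma entry_utilE (g : graph) (n t : nat) :
  symmetric g -> (forall u w, g u w -> (u < n)%N) -> (t < n)%N -> ~~ g t t ->
  (forall w, (w < n)%N -> g t w \/ exists u, g t u /\ g u w) ->
  entry_util b c gamma c0 n g t =
    - c0 * (deg g n t)%:R + (b 1%N - c) +
    (1 - gamma) * ((deg g n t)%:R * (b 2%N - b 3%N) + (n%:R - 1) * b 3%N).
Proof.
move=> gC gn tn ngtt diam; rewrite /entry_util -addrA; congr (_ + _).
set h := add_link g n t.
have gnF w : g n w = false by apply/negP => /gn; rewrite ltnn.
have nt : n != t by rewrite neq_ltn tn orbT.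
have wn_neq w : (w < n)%N -> n != w by move=> wn; rewrite neq_ltn wn orbT.
have hn w : h n w = (w == t) by rewrite /h /add_link gnF eqxx (negPf nt) /= orbF.
have h_old u w : u != n -> w != n -> h u w = g u w.
  by move=> un wn; rewrite /h /add_link (negPf un) (negPf wn) !andbF /= orbF.
have hC : symmetric h.
  move=> u w; rewrite /h /add_link gC; congr (_ || _); rewrite orbC.
  by congr (_ || _); rewrite andbC.
have tn1 : (t < n.+1)%N by apply: ltnW.
(* Replacing the leaf [n] by its only neighbour [t] removes [n] from a walk between other nodes. *)
have leaf k p q : p != n -> q != n -> walk_k predT h n.+1 k p q ->
    walk_k (fun w => w != n) h n.+1 k p q.
  pose f w := if w == n then t else w.
  have fE w : w != n -> f w = w by rewrite /f => /negPf->.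
  have fn : f n = t by rewrite /f eqxx.
  have tn' : t != n by rewrite eq_sym.
  move=> pn qn wpq; rewrite -(fE p) // -(fE q) //.
  apply: (@walk_hom _ predT predT h h n.+1 n.+1 f) wpq => // u w _ un _.
  case: (eqVneq u n) => [->|u_n]; first by rewrite hn fn => /eqP->; left; rewrite fE.
  case: (eqVneq w n) => [->|w_n]; first by rewrite hC hn fn => /eqP->; left; rewrite fE.
  by rewrite !fE // => huw; right.
have no_rent p q : rent b gamma h n.+1 n p q = 0.
  rewrite /rent; case: ifP => // /and5P[_ np nq cpq /negP[]].
  by apply: leaf; rewrite // eq_sym.
(* Such a walk may end at [t], the last node being untested, but cannot go on from there. *)
have through k q : walk_k (fun w => w != t) h n.+1 k n q -> q = n \/ q = t.
  elim: k q => [|k IH] q; first by move/eqP->; left.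
  rewrite walkS => /orP[/IH // | /hasP[w _ /and3P[wt /IH[->|wE _]]]].
  2: by rewrite wE eqxx in wt.
  by rewrite hn => /eqP; right.
(* The subtracted term cancels [b 3] at [w = t], a direct neighbour without indirect benefit. *)
have net w : (w < n)%N -> net_benefit b gamma h n.+1 n w =
    (1 - gamma) * (b 3%N + (g t w)%:R * (b 2%N - b 3%N) - (w == t)%:R * b 3%N).
  move=> wn; have wn' : w != n by rewrite eq_sym wn_neq.
  case: (eqVneq w t) => [->|wt].
    rewrite /net_benefit ltnNge dist_le ?andbF ?(negPf ngtt).
      by rewrite mul0r mul1r addr0 subrr mulr0.
    by rewrite walk1 hn eqxx ltnSn orbT.
  have hnt : h n t by rewrite hn.
  have w3 : walk_k predT h n.+1 3 n w.
    apply: (walk_cons _ _ hnt) => //.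
    case: (diam w wn) => [gtw|[u [gtu guw]]].
      apply: (@walk_mono _ _ _ 1) => //.
      by rewrite walk1 tn1 h_old ?gtw ?orbT // eq_sym.
    have un : u != n by rewrite eq_sym wn_neq // (gn _ _ guw).
    apply: (@walk_cons _ _ _ _ _ u) => //; first by rewrite h_old // eq_sym.
    by rewrite walk1 h_old // guw (leqW (gn _ _ guw)) orbT.
  have cw : conn h n.+1 n w := connW w3.
  have d1 : (1 < dist h n.+1 n w)%N.
    by rewrite dist_gt1 // hn wt wn_neq.
  have nz : ness h n.+1 n w != 0%N.
    rewrite -lt0n; apply: (@ness_essential _ _ t).
    apply/and5P; split; rewrite 1?eq_sym //.
    by apply/negP => /through[] /eqP; rewrite ?(negPf wn') ?(negPf wt).
  rewrite /net_benefit cw d1 nz /= mulr1 mul0r subr0; congr (_ * _).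
  have w2 : walk_k predT h n.+1 2 n w = g t w.
    apply/idP/idP => [|gtw].
      rewrite walkS walk1 hn (negPf wt) (negPf (wn_neq _ wn)) !andbF !orFb.
      case/hasP=> u _ /and3P[_]; rewrite walk1 hn.
      case/orP=> [/eqP<- | /and3P[_ _ /eqP->]]; first by rewrite hn (negPf wt).
      by rewrite h_old // eq_sym.
    apply: (walk_cons _ _ hnt) => //.
    by rewrite walk1 tn1 h_old ?gtw ?orbT // eq_sym.
  have d3 : (dist h n.+1 n w <= 3)%N by apply: dist_le.
  have := dist_leE 2 cw; rewrite w2; case: (g t w) => d2.
    have -> : dist h n.+1 n w = 2%N by apply/eqP; rewrite eqn_leq d2.
    by rewrite mul1r; ring.
  have -> : dist h n.+1 n w = 3%N by apply/eqP; rewrite eqn_leq d3 ltnNge d2.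
  by rewrite mul0r addr0.
have net_n : net_benefit b gamma h n.+1 n n = 0.
  by rewrite /net_benefit ltnNge dist_le ?andbF // walk1 eqxx.
have deg1 : deg h n.+1 n = 1%N.
  rewrite /deg (eq_count (a2 := pred1 t)); last by move=> w; rewrite hn.
  by rewrite count_uniq_mem ?iota_uniq // mem_iota tn1.
rewrite utilE deg1 mul1r -addrA; congr (_ + _).
rewrite [X in _ + X]big1 ?addr0; last by move=> p _; rewrite big1.
rewrite -[in iota 0 n.+1]addn1 iotaD big_cat /= big_seq1 add0n net_n addr0.
have -> : \sum_(w <- iota 0 n) net_benefit b gamma h n.+1 n w = \sum_(w <- iota 0 n)
    (1 - gamma) * (b 3%N + (g t w)%:R * (b 2%N - b 3%N) - (w == t)%:R * b 3%N).
  by rewrite big_seq [RHS]big_seq; apply: eq_bigr => w; rewrite mem_iota => /net.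
rewrite -mulr_sumr; congr (_ * _).
rewrite sumrB big_split /= -mulr_suml sum_iota_delta //.
rewrite big_const_seq count_predT size_iota iter_addr_0.
have -> : \sum_(w <- iota 0 n) (g t w)%:R = (deg g n t)%:R :> R.
  by rewrite -natr_sum /deg -sum1_count [in RHS]big_mkcond; congr (_%:R).
by rewrite -mulr_natr; ring.
Qed.

(** The newcomer is isolated in [g], so [t] forgoes nothing and gains [b 1 - c]. *)
Lemma accepts_newcomer (g : graph) (n t : nat) :
  (forall u w, g u w -> (u < n)%N /\ (w < n)%N) -> (t < n)%N ->
  accepts b c gamma n g t.
Proof.
move=> gn tn; have tNn : t != n by rewrite neq_ltn tn.
apply/ltW; apply: (@util_add_gt _ b c gamma _ _ _ _ g (add_link g n t) n n.+1 t n) => //.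
- apply/negP; rewrite walkS walk1.
  have nF w : g w n = false by apply/negP => /gn[_]; rewrite ltnn.
  by rewrite (negPf tNn) nF andbF /= => /hasP[w _]; rewrite nF !andbF.
- by move=> u w /gn[].
- by move=> u w guw; rewrite /add_link guw.
- by move=> u w ut wt; rewrite /add_link (negPf ut) (negPf wt) andbF /= orbF.
- by move=> w; rewrite /add_link eqxx (negPf tNn).
- by move=> w /gn[].
Qed.

(** The side of [t] will become the new [A], hence its required size. Only odd [n] with [t] in the
    smaller side [A] would violate it, and then a node [s] of the larger side, with degree one less,
    is a better choice. *)
Lemma turan_entry (n : nat) (g : graph) (A : pred nat) (v t : nat) :
  almost_turan n g A v ->
  (forall x y, (x < n)%N -> (y < n)%N -> g x y = (A x != A y)) -> (t < n)%N ->
  (forall t', (t' < n)%N -> accepts b c gamma n g t' ->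
     entry_util b c gamma c0 n g t' <= entry_util b c gamma c0 n g t) ->
  count (fun z => A z == A t) (iota 0 n) = (n.+1)./2.
Proof.
move=> gT full tn best.
have nA : count (fun z => ~~ A z) (iota 0 n) = (n - n./2)%N.
  by rewrite count_complement (at_size gT).
have [At|nAt] := boolP (A t); last first.
  rewrite -[(n.+1)./2]/(uphalf n) uphalf_half.
  have -> : (odd n + n./2 = n - n./2)%N by lia.
  by rewrite -nA; apply: eq_count => z; case: (A z).
have cA : count (fun z => A z == true) (iota 0 n) = n./2.
  by rewrite -(at_size gT); apply: eq_count => z; case: (A z).
rewrite cA; have [on|en] := boolP (odd n); last first.
  by rewrite -[RHS]/(uphalf n) uphalf_half (negPf en).
have [s [sn nAs _]] : exists s, [/\ (s < n)%N, ~~ A s & s \notin [::]].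
  by apply: count_exists; rewrite nA; apply: half_ltB (leq_ltn_trans _ tn).
have gn u w : g u w -> (u < n)%N by case/(at_sub gT).
have irr u : ~~ g u u by apply/negP => /(at_sub gT)[_ _]; rewrite eqxx.
have degt : deg g n t = (n - n./2)%N.
  rewrite -nA; apply: eq_in_count => z; rewrite mem_iota => zn.
  by rewrite full // At; case: (A z).
have degs : deg g n s = n./2.
  rewrite -(at_size gT); apply: eq_in_count => z; rewrite mem_iota => zn.
  by rewrite full // (negPf nAs); case: (A z).
have gts : g t s by rewrite full // At (negPf nAs).
have gst : g s t by rewrite (at_sym gT).
have diam p q : (p < n)%N -> (q < n)%N -> A p != A q ->
    forall w, (w < n)%N -> g p w \/ exists u, g p u /\ g u w.
  move=> pn qn Apq w wn; have [Apw|Apw] := eqVneq (A p) (A w); last by left; rewrite full.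
  by right; exists q; split; rewrite full // -Apw eq_sym.
have Ats : A t != A s by rewrite At (negPf nAs).
have gn2 u w : g u w -> (u < n)%N /\ (w < n)%N by case/(at_sub gT).
have := best s sn (accepts_newcomer gn2 sn).
have Ast : A s != A t by rewrite eq_sym.
rewrite (entry_utilE (at_sym gT) gn sn (irr s) (diam s t sn tn Ast)).
rewrite (entry_utilE (at_sym gT) gn tn (irr t) (diam t s tn sn Ats)).
(* One more unit of degree changes the entry utility by [(1 - gamma) * (b 2 - b 3) - c0], which is
   negative. *)
rewrite degt degs odd_halfB // -natr1 => worse; exfalso.
by have := hc0_lo; lra.
Qed.

(** * Preservation of the invariant *)

Lemma almost_turan_add (n : nat) (g : graph) (A : pred nat) (v i j : nat) :
  almost_turan n g A v -> (i < n)%N -> (j < n)%N -> A i != A j ->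
  almost_turan n (add_link g i j) A v.
Proof.
move=> gT iltn jltn Aij; split.
- exact: at_v gT.
- exact: at_vA gT.
- exact: at_size gT.
- move=> x y /or3P[/(at_sub gT)//|/andP[/eqP-> /eqP->]//|/andP[/eqP-> /eqP->]].
  by rewrite eq_sym.
- move=> x y; rewrite /add_link (at_sym gT); congr (_ || _).
  by rewrite orbC; congr (_ || _); rewrite andbC.
- by move=> x y xn yn xv yv Axy; rewrite /add_link (at_full gT).
- by move=> a an /(at_link gT an)[s gvs]; exists s; rewrite /add_link gvs.
Qed.

Lemma reached_almost_turan (n : nat) (g : graph) :
  reached b c gamma c0 n g -> exists A v, almost_turan n g A v.
Proof.
elim=> {n g} [|n g t _ [A [v gT]] st tn _ _ best|n g i j _ [A [v gT]] _ iltn|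
              n g i j _ [A [v gT]] _ _ gij lt _].
- by exists pred0, 0%N; split=> // x y; rewrite !ltnS !leqn0 => /eqP->.
- have full := stable_complete gT st.
  (* The side joined by the newcomer becomes [A] and the newcomer the exceptional node; the test
     [z < n] keeps it out of [A], whatever the old predicate says at [n]. *)
  exists (fun z => (z < n)%N && (A z == A t)), n.
  have gA x y : g x y -> [/\ (x < n)%N, (y < n)%N & A x != A y] by case/(at_sub gT).
  have old x : (x < n.+1)%N -> x != n -> (x < n)%N by rewrite ltnS ltn_neqAle => ->->.
  split.
  + exact: ltnSn.
  + by rewrite ltnn.
  + rewrite -(turan_entry gT full tn best) -[in LHS]addn1 iotaD count_cat /= ltnn !addn0.
    by apply: eq_in_count => z; rewrite mem_iota => /= ->.
  + have key : (n < n.+1)%N /\ (t < n.+1)%N by rewrite ltnSn ltnW.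
    move=> x y /or3P[/gA[xn yn Axy]|/andP[/eqP-> /eqP->]|/andP[/eqP-> /eqP->]].
    * rewrite !ltnS xn yn ltnW // ltnW //=; split=> //.
      by move: Axy; case: (A x); case: (A y); case: (A t).
    * by case: key; rewrite ltnn tn eqxx.
    * by case: key; rewrite ltnn tn eqxx.
  + move=> x y; rewrite /add_link (at_sym gT); congr (_ || _).
    by rewrite orbC; congr (_ || _); rewrite andbC.
  + move=> x y xn yn xN yN; have xn' := old x xn xN; have yn' := old y yn yN.
    rewrite /add_link xn' yn' full //=.
    by case: (A x); case: (A y); case: (A t).
  + by move=> a _ _; exists t; rewrite /add_link !eqxx orbT.
- case/and4P=> jltn ji ngij le lt _; exists A, v; apply: almost_turan_add => //.
  (* Proposer and receiver both do not lose, whereas a link inside one side makes one of them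
     lose. *)
  apply/negP => /eqP Aij.
  case: (same_side_refused gT (g' := add_link g i j) iltn jltn _ Aij) => //.
  + by rewrite eq_sym.
  + by rewrite ltNge ltW.
  + by rewrite ltNge le.
- have := util_del_lt (at_sym gT) (at_sub gT) gij.
  by rewrite ltNge ltW.
Qed.

End Dynamics.

Theorem theorem3 (R : realFieldType) (b : nat -> R) (c gamma c0 : R)
  (hb_dec : forall i : nat, (0 < i)%N -> b i.+1 < b i)
  (hb_pos : forall i : nat, (0 < i)%N -> 0 < b i)
  (hgamma0 : 0 <= gamma) (hgamma1 : gamma < 1)
  (hgamma : gamma < (b 2%N - b 3%N) / (3 * b 2%N - b 3%N))
  (hc_lo : b 1%N - b 2%N + gamma * (3 * b 2%N - b 3%N) < c)
  (hc_hi : c < b 1%N - b 3%N)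
  (hc0_lo : (1 - gamma) * (b 2%N - b 3%N) < c0)
  (hc0_hi : c0 <= (1 - gamma) * b 2%N) :
  forall (n : nat) (g : graph),
    reached b c gamma c0 n g -> pairwise_stable b c gamma n g ->
    bipartite_turan n g.
Proof.
move=> n g reach stable.
have [A [v gT]] :=
  reached_almost_turan hb_dec hb_pos hgamma0 hgamma1 hc_lo hc_hi hc0_lo reach.
exists A; split; first exact: at_size gT.
exact: (stable_complete hb_dec hb_pos hgamma0 hgamma1 hc_hi gT stable).
Qed.
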